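(* Let $X$ be a finite set, let $f$ be a Plott function on $X$, and let $(Y,\le,\psi)$ be an SS-rationalization of $f$ with $Y$ finite. Then $|Y|\ge |\mathcal P(f)|$, where $\mathcal P(f)$ is the set of all pieces of the convex geometry corresponding to $f$.
   Context: A choice function on $X$ is a map $f:2^X\to 2^X$ with $f(A)\subset A$ for all $A\subset X$ (empty values are allowed). $f$ is a Plott function if $f(A\cup B)=f(f(A)\cup B)$ for all $A,B\subset X$. The convex geometry $\mathcal F$ corresponding to a Plott function $f$ is the family of closed (also called convex) sets of the closure operator on $X$ under which the closure of $A\subset X$ is $\{x\in X: f(A)=f(A\cup\{x\})\}$. A set $P\in\mathcal F$ is a piece of an element $x\in X$ if $x\notin P$ and $x\in Q$ for every $Q\in\mathcal F$ with $P\subset Q$, $P\neq Q$. A set $P\in\mathcal F$ is a piece if it is a piece of some element of $X$; $\mathcal P(f)$ is the set of all pieces. For a partial order $\le$ on a finite set $Y$, the Plott function on $Y$ rationalizable by $\le$ is $g(B)=\{$maximal elements of $B$ with respect to $\le\}$, $B\subset Y$. For a map $\psi:Y\to X$ and a choice function $g$ on $Y$, the direct image is $\psi_*(g)(A)=\psi(g(\psi^{-1}(A)))$, $A\subset X$. A triple $(Y,\le,\psi)$, with $\le$ a partial order on $Y$ and $\psi:Y\to X$ a map, is an SS-rationalization of $f$ if $f=\psi_*(g)$, where $g$ is the Plott function on $Y$ rationalizable by $\le$. *)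

(* Defs.v *)
From mathcomp Require Import all_boot all_order.

Set Implicit Arguments.
Unset Strict Implicit.
Unset Printing Implicit Defensive.

Import Order.TTheory.

Definition choice_function (X : finType) (f : {set X} -> {set X}) : Prop :=
  forall A : {set X}, f A \subset A.

Definition plott_function (X : finType) (f : {set X} -> {set X}) : Prop :=
  choice_function f /\
  forall A B : {set X}, f (A :|: B) = f (f A :|: B).

Definition plott_closure (X : finType) (f : {set X} -> {set X})
  (A : {set X}) : {set X} := [set x | f A == f (A :|: [set x])].

Definition convex_geometry (X : finType) (f : {set X} -> {set X}) :
  {set {set X}} := [set A | plott_closure f A == A].

Definition piece_of (X : finType) (F : {set {set X}}) (x : X) (P : {set X}) :
  bool :=
  [&& P \in F, x \notin P & [forall Q in F, (P \proper Q) ==> (x \in Q)]].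

Definition pieces (X : finType) (f : {set X} -> {set X}) : {set {set X}} :=
  [set P | [exists x, piece_of (convex_geometry f) x P]].

Definition rationalizable (d : Order.disp_t) (Y : finPOrderType d)
  (B : {set Y}) : {set Y} :=
  [set y in B | [forall z in B, ~~ (y < z)%O]].

Definition direct_image (X Y : finType) (psi : Y -> X)
  (g : {set Y} -> {set Y}) (A : {set X}) : {set X} :=
  psi @: g (psi @^-1: A).

Definition SS_rationalization (X : finType) (f : {set X} -> {set X})
  (d : Order.disp_t) (Y : finPOrderType d) (psi : Y -> X) : Prop :=
  f =1 direct_image psi (@rationalizable d Y).

(* Main.v *)
Require Import Defs.
From mathcomp Require Import all_boot all_order.

(** Each [y : Y] determines the set [avoider psi y] of all points of [X] that
    have no representation [psi z] with [y <= z].  Call it [P_y].  The claim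
    is that every piece is some [P_y], so that there are at most [#|Y|] pieces.

    The link between the closure operator and the order is
    [notin_plott_closureP]: a point [x] outside [A] is outside the closure of
    [A] exactly when some [y] over [x] lies below no element over [A], that
    is, when [A] is contained in some [P_y] with [psi y = x].  From right to
    left this shows that each [P_y] is closed, because upsets are transitive.
    From left to right, a piece [P] of [x] is closed and misses [x], hence
    lies in some [P_y] with [psi y = x]; this [P_y] is closed and misses [x]
    too, so the maximality of [P] forces [P = P_y]. *)

Set Implicit Arguments.
Unset Strict Implicit.
Unset Printing Implicit Defensive.

Import Order.TTheory.

Definition avoider (X : finType) (d : Order.disp_t) (Y : finPOrderType d)
  (psi : Y -> X) (y : Y) : {set X} :=
  ~: (psi @: [set z | (y <= z)%O]).

Lemma rationalizable_above (d : Order.disp_t) (Y : finPOrderType d)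
    (B : {set Y}) (y : Y) :
  y \in B -> exists2 z, z \in rationalizable B & (y <= z)%O.
Proof.
move=> yB; have Py : (y \in B) && (y <= y)%O by rewrite yB lexx.
(* The cardinality of the principal downset is strictly increasing in z. *)
case: (@arg_maxnP _ y (fun z => (z \in B) && (y <= z)%O)
         (fun z => #|[set t | (t <= z)%O]|) Py) => z /andP[zB yz] zmax.
exists z => //; rewrite inE zB; apply/forall_inP => t tB.
apply/negP => zt.
have := zmax t; rewrite tB (le_trans yz (ltW zt)) => /(_ isT).
apply/negP; rewrite -ltnNge; apply: proper_card; apply/properP; split.
  by apply/subsetP => u; rewrite !inE => uz; exact: le_trans uz (ltW zt).
by exists t; rewrite inE ?lexx // (lt_geF zt).
Qed.

Section Rationalization.

Variables (X : finType) (f : {set X} -> {set X}).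
Variables (d : Order.disp_t) (Y : finPOrderType d) (psi : Y -> X).
Hypothesis f_psi : SS_rationalization f psi.

Lemma sub_avoiderP (A : {set X}) (y : Y) :
  reflect (forall z, psi z \in A -> ~~ (y <= z)%O) (A \subset avoider psi y).
Proof.
apply: (iffP subsetP) => [sA z zA | sA x xA].
  apply/negP => yz; move: (sA _ zA); rewrite inE; apply/negP/negPn.
  by apply: imset_f; rewrite inE.
rewrite inE; apply/imsetP => -[z]; rewrite inE => yz xz.
by move: (sA z); rewrite -xz yz => /(_ xA).
Qed.

(** If each point over [x] is dominated by a point over [A], then adding [x]
    to [A] creates no new maximal element and destroys none, so [f] does not
    change.  Conversely, a [y] over [x] with nothing over [A] above it extends
    to a maximal element, which must lie over [x], so that [x] is chosen from
    [A] with [x] added, but not from [A]. *)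
Lemma notin_plott_closureP (A : {set X}) (x : X) : x \notin A ->
  reflect (exists2 y, psi y = x & A \subset avoider psi y)
          (x \notin plott_closure f A).
Proof.
move=> xA; rewrite inE; apply: (iffP idP) => [nf | [y yx /sub_avoiderP yA]].
  have [/exists_inP[y /eqP yx yA]|no] :=
    boolP [exists y in [pred y | psi y == x], A \subset avoider psi y].
    by exists y.
  have dom t : psi t = x -> exists2 z, psi z \in A & (t < z)%O.
    move=> tx; move/exists_inPn: no => /(_ t); rewrite inE tx eqxx => /(_ isT).
    move=> /sub_avoiderP no.
    have [/exists_inP[z zA tz]|/exists_inPn none] :=
      boolP [exists z in [pred z | psi z \in A], (t <= z)%O].
      exists z => //; rewrite lt_neqAle tz andbT.
      by apply: contraNneq xA => tz'; rewrite -tx tz'.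
    by case: no => z zA; exact: none.
  case/negP: nf; rewrite !f_psi /direct_image; apply/eqP.
  suff -> : rationalizable (psi @^-1: A) =
            rationalizable (psi @^-1: (A :|: [set x])) by [].
  apply/setP => t; rewrite !inE; have [tx|tx] := eqVneq (psi t) x.
    rewrite tx (negPf xA) /=; apply/esym/negP => /forall_inP tmax.
    have [z zA tz] := dom t tx.
    by have := tmax z; rewrite !inE zA tz => /(_ isT).
  rewrite orbF; congr (_ && _).
  apply/forall_inP/forall_inP => tmax z; rewrite !inE; last first.
    by move=> zA; apply: tmax; rewrite !inE zA.
  case/orP => [zA|/eqP zx]; first by apply: tmax; rewrite inE.
  have [w wA zw] := dom z zx; apply/negP => tz.
  by have := tmax w; rewrite inE wA (lt_trans tz zw) => /(_ isT).
have yB : y \in psi @^-1: (A :|: [set x]) by rewrite !inE yx eqxx orbT.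
have [z zmax yz] := rationalizable_above yB.
have zx : psi z = x.
  move: (zmax); rewrite !inE => /andP[/orP[zA|/eqP //] _].
  by move: (yA z zA); rewrite yz.
apply: contraNneq xA => eqf.
have: x \in f A by rewrite eqf f_psi; apply/imsetP; exists z.
by rewrite f_psi => /imsetP[t]; rewrite !inE => /andP[tA _] ->.
Qed.

Lemma convex_geometryP (A : {set X}) :
  reflect (forall x, x \notin A ->
             exists2 y, psi y = x & A \subset avoider psi y)
          (A \in convex_geometry f).
Proof.
rewrite inE; apply: (iffP eqP) => [clA x xA | sep].
  by apply/(notin_plott_closureP xA); rewrite clA.
apply/setP => x; have [xA|xA] := boolP (x \in A).
  by rewrite inE setUC (setUidPr _) ?sub1set ?eqxx.
by apply/negbTE/(notin_plott_closureP xA)/sep.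
Qed.

Lemma avoider_convex (y : Y) : avoider psi y \in convex_geometry f.
Proof.
apply/convex_geometryP => x; rewrite inE negbK => /imsetP[z].
rewrite inE => yz ->; exists z => //; rewrite setCS; apply: imsetS.
by apply/subsetP => t; rewrite !inE; exact: le_trans yz.
Qed.

Lemma piece_avoider (x : X) (P : {set X}) :
  piece_of (convex_geometry f) x P -> exists y, P = avoider psi y.
Proof.
case/and3P => PF xP /forall_inP Pmax.
have [y yx Py] := convex_geometryP _ PF x xP.
exists y; apply/eqP; apply: contraT => neq.
have : x \in avoider psi y.
  by apply: (implyP (Pmax _ (avoider_convex y))); rewrite properEneq neq.
by rewrite inE -yx imset_f // inE.
Qed.

End Rationalization.

Theorem mainTheorem6 (X : finType) (f : {set X} -> {set X})
  (hf : plott_function f) (d : Order.disp_t) (Y : finPOrderType d)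
  (psi : Y -> X) (hpsi : SS_rationalization f psi) :
  #|pieces f| <= #|Y|.
Proof.
rewrite -cardsT; apply: leq_trans (leq_imset_card (avoider psi) _).
apply/subset_leq_card/subsetP => P; rewrite inE => /existsP[x].
by move/(piece_avoider hpsi) => [y ->]; apply: imset_f; rewrite inE.
Qed.
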